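(* Let $f,g\colon H\rightrightarrows K$ be a pair of parallel morphisms in $\mathsf{AtoMon}$, and define $$\mathscr A_{f,g}(H):=\{x\in\mathscr A(H): f(x)=g(x)\}\quad\text{and}\quad H^\times_{f,g}:=\{x\in H^\times: f(x)=g(x)\}.$$ Let $E(f,g)$ be the submonoid of $H$ generated by $\mathscr A_{f,g}(H)\cup H^\times_{f,g}$, and let $e\colon E(f,g)\to H$ be the inclusion map. Then the equalizer of $f$ and $g$ in $\mathsf{AtoMon}$ exists and is given by $e\colon E(f,g)\to H$.
   Context: Monoids are not assumed commutative. For a monoid $H$, $H^\times$ is the group of units (two-sided invertible elements). An atom of $H$ is a non-unit $a\in H$ such that $a=xy$ with $x,y\in H$ implies $x\in H^\times$ or $y\in H^\times$; $\mathscr A(H)$ is the set of atoms. $H$ is atomic if every non-unit of $H$ is a (non-empty, finite) product of atoms. A monoid homomorphism $f\colon H\to K$ is atom-preserving if $f(a)\in\mathscr A(K)$ for every $a\in\mathscr A(H)$. $\mathsf{AtoMon}$ is the category whose objects are the atomic monoids and whose morphisms are the atom-preserving monoid homomorphisms between atomic monoids. *)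

(* Defs.v *)
From HB Require Import structures.
From mathcomp Require Import all_boot.
From mathcomp Require Import boolp classical_sets.

Set Implicit Arguments.
Unset Strict Implicit.
Unset Printing Implicit Defensive.

Local Open Scope group_scope.
Local Open Scope classical_set_scope.

(* [monoidType] is the library's type of possibly non-commutative monoids. Its
   elements also carry a [choiceType] structure, which every type has in
   classical logic; monoid homomorphisms ([UMagmaMorphism.type]) ignore it. *)

Definition units (H : monoidType) : set H :=
  [set x : H | exists y : H, x * y = 1 /\ y * x = 1].

Definition atoms (H : monoidType) : set H :=
  [set a : H | ~ units a /\ forall x y : H, a = x * y -> units x \/ units y].

Definition atomic (H : monoidType) : Prop :=
  forall x : H, ~ units x -> exists s : seq H,
    [/\ s <> [::], forall a, a \in s -> atoms a & x = \prod_(a <- s) a].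

Definition atom_preserving (H K : monoidType) (f : H -> K) : Prop :=
  forall a, atoms a -> atoms (f a).

Definition gen_submonoid (H : monoidType) (A : set H) : set H :=
  smallest (fun S : set H => monoid_closed (mem S)) A.

Section GeneratedSubmonoid.
Variables (H : monoidType) (A : set H).

(* Membership in a classical set is Boolean-valued by excluded middle, so the
   generated submonoid is a subtype of [H] in the sense of the library. *)
Record gen_monoid := GenMonoid {
  gen_val : H;
  gen_valP : gen_val \in gen_submonoid A
}.

HB.instance Definition _ := [isSub for gen_val].
HB.instance Definition _ := [Choice of gen_monoid by <:].

Fact gen_monoid_closed : monoid_closed [in gen_submonoid A].
Proof.
split=> [|x y].
  by rewrite inE => S [[S1 _] _]; rewrite inE in S1.
rewrite !inE => Gx Gy S SP; case: (SP) => -[_ SM] _.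
have := SM x y; rewrite !inE; apply; first exact: Gx.
exact: Gy.
Qed.

HB.instance Definition _ :=
  SubChoice_isSubMonoid.Build H [in gen_submonoid A] gen_monoid
    gen_monoid_closed.

End GeneratedSubmonoid.

Record category := Category {
  cat_obj :> Type;
  cat_hom : cat_obj -> cat_obj -> Type;
  cat_id : forall X, cat_hom X X;
  cat_comp : forall X Y Z, cat_hom Y Z -> cat_hom X Y -> cat_hom X Z;
  cat_compIf : forall X Y (f : cat_hom X Y), cat_comp (cat_id Y) f = f;
  cat_compfI : forall X Y (f : cat_hom X Y), cat_comp f (cat_id X) = f;
  cat_compA : forall X Y Z W (h : cat_hom Z W) (g : cat_hom Y Z)
    (f : cat_hom X Y), cat_comp h (cat_comp g f) = cat_comp (cat_comp h g) f
}.

Definition is_equalizer (C : category) (X Y : C) (f g : cat_hom X Y)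
    (E : C) (e : cat_hom E X) : Prop :=
  cat_comp f e = cat_comp g e /\
  forall (L : C) (h : cat_hom L X), cat_comp f h = cat_comp g h ->
    exists! k : cat_hom L E, cat_comp e k = h.

Record atomic_monoid := AtomicMonoid {
  atomic_sort :> monoidType;
  atomicP : atomic atomic_sort
}.

Record atomon_hom (H K : atomic_monoid) := AtomonHom {
  atomon_fun :> UMagmaMorphism.type H K;
  atomon_homP : atom_preserving atomon_fun
}.

Lemma atomon_hom_ext (H K : atomic_monoid) (f g : atomon_hom H K) :
  f =1 g -> f = g.
Proof.
case: f g => [[f [[fM] [f1]]] fP] [[g [[gM] [g1]]] gP] /= /funext fg.
move: fg fM f1 fP gM g1 gP => /= -> fM f1 fP gM g1 gP.
rewrite (Prop_irrelevance fM gM) (Prop_irrelevance f1 g1) in fP *.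
by rewrite (Prop_irrelevance fP gP).
Qed.

Definition atomon_id (H : atomic_monoid) : atomon_hom H H :=
  @AtomonHom H H idfun (fun _ Aa => Aa).

Definition atomon_comp (H K L : atomic_monoid)
    (g : atomon_hom K L) (f : atomon_hom H K) : atomon_hom H L :=
  @AtomonHom H L (g \o f) (fun _ Aa => atomon_homP g (atomon_homP f Aa)).

Definition AtoMon : category.
Proof.
refine (@Category atomic_monoid atomon_hom atomon_id atomon_comp _ _ _).
- by move=> H K f; apply: atomon_hom_ext.
- by move=> H K f; apply: atomon_hom_ext.
- by move=> H K L M h g f; apply: atomon_hom_ext.
Defined.

Section Equalizer.
Variables (H K : monoidType) (f g : H -> K).

Definition eq_atoms : set H := [set x | atoms x /\ f x = g x].
Definition eq_units : set H := [set x | units x /\ f x = g x].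
Definition eq_monoid : monoidType := gen_monoid (eq_atoms `|` eq_units).

Definition eq_incl : UMagmaMorphism.type eq_monoid H :=
  (val : gen_monoid (eq_atoms `|` eq_units) -> H).

End Equalizer.

(* Main.v *)
Require Import Defs.
From HB Require Import structures.
From mathcomp Require Import all_boot.
From mathcomp Require Import boolp classical_sets.

(** A product of atoms and units is, after absorbing each unit into a
    neighbouring atom, either a unit or a non-empty product of atoms; and a
    unit on which [f] and [g] agree turns an atom on which they agree into
    another such atom. Hence every element of [E(f,g)] is either a unit or a
    non-empty product of atoms of [H] that lie in [E(f,g)]
    ([eq_submonoidP]).

    Moreover [f] and [g] also agree on the inverse of a unit on which they
    agree, so [E(f,g)] contains the inverses of those of its elements that are
    units of [H]: being a unit means the same in [E(f,g)] and in [H]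
    ([units_eq_val]). Together these two facts identify the atoms of [E(f,g)]
    with the equalized atoms of [H] ([atoms_eq_val]): an atom of [E(f,g)] is a
    product of equalized atoms of [H], the first of which must then be
    associated with it. So [E(f,g)] is atomic and its inclusion preserves and
    reflects atoms.

    For the universal property, let [h : L -> H] in [AtoMon] equalize [f] and
    [g]. It sends atoms to equalized atoms and units to equalized units. Since
    [L] is atomic, its atoms and units generate it, so [h] takes its values in
    [E(f,g)]; as the inclusion reflects atoms, the corestriction of [h]
    preserves them. *)

Set Implicit Arguments.
Unset Strict Implicit.
Unset Printing Implicit Defensive.

Local Open Scope group_scope.
Local Open Scope classical_set_scope.

(** * Units and atoms *)

Lemma units1 (H : monoidType) : units (1 : H).
Proof. by exists 1; rewrite mulg1. Qed.

Lemma unitsM (H : monoidType) (u v : H) : units u -> units v -> units (u * v).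
Proof.
move=> [u' [uu' u'u]] [v' [vv' v'v]]; exists (v' * u'); split.
  by rewrite mulgA -(mulgA u) vv' mulg1.
by rewrite mulgA -(mulgA v') u'u mulg1.
Qed.

Lemma units_inv (H : monoidType) (u v : H) : u * v = 1 -> v * u = 1 -> units v.
Proof. by move=> uv vu; exists u. Qed.

Lemma atoms_mull (H : monoidType) (u a : H) :
  units u -> atoms a -> atoms (u * a).
Proof.
move=> uu [aN aP]; case: (uu) => v [uv vu].
have vU : units v by apply: units_inv uv vu.
split=> [uaU|x y /(congr1 ( *%g v))].
  by apply: aN; rewrite -[a]mul1g -vu -mulgA; apply: unitsM.
rewrite !mulgA vu mul1g => /aP[vxU|]; [left|by right].
by rewrite -[x]mul1g -uv -mulgA; apply: unitsM.
Qed.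

Lemma atoms_mulr (H : monoidType) (u a : H) :
  units u -> atoms a -> atoms (a * u).
Proof.
move=> uu [aN aP]; case: (uu) => v [uv vu].
have vU : units v by apply: units_inv uv vu.
split=> [auU|x y /(congr1 ( *%g^~ v))].
  by apply: aN; rewrite -[a]mulg1 -uv mulgA; apply: unitsM.
rewrite -!mulgA uv mulg1 => /aP[|yvU]; [by left|right].
by rewrite -[y]mulg1 -vu mulgA; apply: unitsM.
Qed.

Lemma units_morph (H K : monoidType) (f : UMagmaMorphism.type H K) (u : H) :
  units u -> units (f u).
Proof.
by move=> [v [uv vu]]; exists (f v); rewrite -!gmulfM uv vu gmulf1.
Qed.

(** * Generated submonoids *)

Lemma sub_gen_submonoid (H : monoidType) (A : set H) : A `<=` gen_submonoid A.
Proof. exact: sub_smallest. Qed.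

Lemma gen_submonoid_ind (H : monoidType) (A S : set H) :
  S 1 -> (forall x y, S x -> S y -> S (x * y)) -> A `<=` S ->
  gen_submonoid A `<=` S.
Proof.
move=> S1 SM AS; apply: smallest_sub => //.
by split=> [|x y]; rewrite !inE //; apply: SM.
Qed.

Lemma gen_submonoid_prod (H : monoidType) (A : set H) (s : seq H) :
  (forall a, a \in s -> gen_submonoid A a) ->
  gen_submonoid A (\prod_(a <- s) a).
Proof.
have [G1 GM] := gen_monoid_closed A.
move=> sG; rewrite big_seq; apply: big_ind => //; first by rewrite inE in G1.
by move=> x y Gx Gy; have := GM x y; rewrite !inE; apply.
Qed.

(** A factor from [U] multiplying a non-empty product of elements of [A] from
    the left is absorbed into its first factor, one multiplying from the right
    into its last. *)
Lemma gen_submonoid_absorb (H : monoidType) (A U : set H) :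
    U 1 -> (forall u v, U u -> U v -> U (u * v)) ->
    (forall u a, U u -> A a -> A (u * a)) ->
    (forall u a, U u -> A a -> A (a * u)) ->
  forall x, gen_submonoid (A `|` U) x ->
    U x \/ exists s : seq H,
      [/\ s <> [::], forall a, a \in s -> A a & x = \prod_(a <- s) a].
Proof.
move=> U1 UM UA AU; apply: gen_submonoid_ind; first by left.
  move=> x y [Ux|[s [s0 sA ->]]] [Uy|[t [t0 tA ->]]].
  - by left; apply: UM.
  - right; case: t t0 tA => // a t _ tA; exists (x * a :: t); split=> //.
      move=> b; rewrite inE => /predU1P[->|bt].
        by apply: UA => //; apply: tA; rewrite mem_head.
      by apply: tA; rewrite inE bt orbT.
    by rewrite !big_cons mulgA.
  - right; case/lastP: s s0 sA => // s a _ sA.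
    exists (rcons s (a * y)); split=> [|b|]; first by case: (s).
      rewrite mem_rcons inE => /predU1P[->|bs].
        by apply: AU => //; apply: sA; rewrite mem_rcons mem_head.
      by apply: sA; rewrite mem_rcons inE bs orbT.
    by rewrite -!cats1 !big_cat !big_seq1 /= mulgA.
  - right; exists (s ++ t); split=> [|a|]; first by case: (s) s0.
      by rewrite mem_cat => /orP[/sA|/tA].
    by rewrite big_cat.
move=> x [Ax|Ux]; [right|by left].
exists [:: x]; split=> // [a|]; first by rewrite inE => /eqP->.
by rewrite big_seq1.
Qed.

Definition gen_corestr (L H : monoidType) (A : set H)
    (h : UMagmaMorphism.type L H) (hA : forall x, h x \in gen_submonoid A)
    (x : L) : gen_monoid A :=
  GenMonoid (hA x).

Fact gen_corestrM (L H : monoidType) (A : set H)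
    (h : UMagmaMorphism.type L H) (hA : forall x, h x \in gen_submonoid A) :
  {morph gen_corestr hA : x y / x * y}.
Proof. by move=> x y; apply: val_inj; rewrite gmulfM /= gmulfM. Qed.

Fact gen_corestr1 (L H : monoidType) (A : set H)
    (h : UMagmaMorphism.type L H) (hA : forall x, h x \in gen_submonoid A) :
  gen_corestr hA 1 = 1.
Proof. by apply: val_inj; rewrite gmulf1 /= gmulf1. Qed.

HB.instance Definition _ (L H : monoidType) (A : set H)
    (h : UMagmaMorphism.type L H) (hA : forall x, h x \in gen_submonoid A) :=
  isMultiplicative.Build L (gen_monoid A) (gen_corestr hA) (gen_corestrM hA).

HB.instance Definition _ (L H : monoidType) (A : set H)
    (h : UMagmaMorphism.type L H) (hA : forall x, h x \in gen_submonoid A) :=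
  Multiplicative_isUMagmaMorphism.Build L (gen_monoid A) (gen_corestr hA)
    (gen_corestr1 hA).

(** * The submonoid generated by the equalized atoms and units *)

Lemma eq_submonoid_equalizes (H K : monoidType)
    (f g : UMagmaMorphism.type H K) (x : eq_monoid f g) :
  f (val x) = g (val x).
Proof.
have := valP x; rewrite inE; move: (val x).
apply: (gen_submonoid_ind (S := [set y : H | f y = g y])) => /=.
- by rewrite !gmulf1.
- by move=> y z fgy fgz; rewrite !gmulfM fgy fgz.
- by move=> y [[]|[]].
Qed.

(** Inverses are unique in [K], so they inherit the agreement of [f] and
    [g]. *)
Lemma eq_units_inv (H K : monoidType) (f g : UMagmaMorphism.type H K)
    (u v : H) : u * v = 1 -> v * u = 1 -> f u = g u -> eq_units f g v.
Proof.
move=> uv vu fgu; split; first exact: units_inv uv vu.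
by rewrite -[f v]mulg1 -(gmulf1 (s := g)) -uv gmulfM -fgu mulgA -gmulfM vu
  gmulf1 mul1g.
Qed.

Lemma units_eq_val (H K : monoidType) (f g : UMagmaMorphism.type H K)
    (x : eq_monoid f g) : units (val x) <-> units x.
Proof.
split=> [[v [xv vx]]|]; last exact: (units_morph (eq_incl f g)).
have vG : v \in gen_submonoid (eq_atoms f g `|` eq_units f g).
  rewrite inE; apply: sub_gen_submonoid; right.
  by apply: eq_units_inv xv vx _; apply: eq_submonoid_equalizes.
by exists (GenMonoid vG); split; apply: val_inj; rewrite gmulfM gmulf1.
Qed.

Lemma eq_submonoidP (H K : monoidType) (f g : UMagmaMorphism.type H K)
    (x : eq_monoid f g) :
  units x \/ exists s : seq (eq_monoid f g),
    [/\ s <> [::], forall a, a \in s -> atoms (val a) &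
        x = \prod_(a <- s) a].
Proof.
have xG : gen_submonoid (eq_atoms f g `|` eq_units f g) (val x).
  by have := valP x; rewrite inE.
have [||||[xU _]|[s [s0 sA xs]]] := gen_submonoid_absorb _ _ _ _ xG.
- by split; [apply: units1|rewrite !gmulf1].
- move=> u v [uU fgu] [vU fgv].
  by split; [apply: unitsM|rewrite !gmulfM fgu fgv].
- move=> u a [uU fgu] [aA fga].
  by split; [apply: atoms_mull|rewrite !gmulfM fgu fga].
- move=> u a [uU fgu] [aA fga].
  by split; [apply: atoms_mulr|rewrite !gmulfM fgu fga].
- by left; apply/units_eq_val.
right.
have sG a : a \in s -> a \in gen_submonoid (eq_atoms f g `|` eq_units f g).
  by move=> /sA Aa; rewrite inE; apply: sub_gen_submonoid; left.
have [t st] : exists t : seq (eq_monoid f g), s = map val t.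
  elim: (s) sG => [|a r IHr] rG; first by exists [::].
  have [b br|t ->] := IHr; first by apply: rG; rewrite inE br orbT.
  by exists (GenMonoid (rG a (mem_head _ _)) :: t).
exists t; split=> [t0|a ta|]; first by rewrite st t0 in s0.
  by have [] : eq_atoms f g (val a) by apply: sA; rewrite st map_f.
by apply: val_inj; rewrite xs st big_map -(gmulf_prod (eq_incl f g)).
Qed.

Lemma atoms_eq_val (H K : monoidType) (f g : UMagmaMorphism.type H K)
    (x : eq_monoid f g) : atoms (val x) <-> atoms x.
Proof.
split=> [[xN xP]|[xN xP]].
  split=> [/units_eq_val//|y z xyz].
  by have [] := xP (val y) (val z); rewrite ?xyz ?gmulfM // => /units_eq_val;
    [left|right].
have [//|[[|a s] [// _ sA xE]]] := eq_submonoidP x.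
have aA : atoms (val a) by apply: sA; rewrite mem_head.
rewrite big_cons in xE.
(* The first factor is not a unit, so the product of the others is one. *)
have [/units_eq_val aU|/units_eq_val pU] := xP _ _ xE; first by case: aA.
by rewrite xE gmulfM; apply: atoms_mulr.
Qed.

Lemma eq_monoid_atomic (H K : monoidType) (f g : UMagmaMorphism.type H K) :
  atomic (eq_monoid f g).
Proof.
move=> x xN; have [//|[s [s0 sA ->]]] := eq_submonoidP x.
by exists s; split=> // a /sA /atoms_eq_val.
Qed.

Lemma eq_incl_atom_preserving (H K : monoidType)
    (f g : UMagmaMorphism.type H K) : atom_preserving (eq_incl f g).
Proof. by move=> x /atoms_eq_val. Qed.

(** An atomic monoid is generated by its atoms and units, whose images lie
    among the generators of [E(f,g)]. *)
Lemma equalizing_image (L : atomic_monoid) (H K : monoidType)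
    (f g : UMagmaMorphism.type H K) (h : UMagmaMorphism.type L H) :
    atom_preserving h -> (forall x, f (h x) = g (h x)) ->
  forall x, h x \in gen_submonoid (eq_atoms f g `|` eq_units f g).
Proof.
move=> hA fgh x; rewrite inE.
have [xU|/atomicP[s [_ sA ->]]] := pselect (units x).
  by apply: sub_gen_submonoid; right; split=> //; apply: units_morph.
rewrite gmulf_prod -(big_map h predT id); apply: gen_submonoid_prod.
move=> _ /mapP[a /sA aA ->].
by apply: sub_gen_submonoid; left; split=> //; apply: hA.
Qed.

(** * The equalizer *)

Theorem proposition6p4 (H K : atomic_monoid) (f g : atomon_hom H K) :
  exists (E_atomic : atomic (eq_monoid f g))
         (e_atom : atom_preserving (eq_incl f g)),
    let E : atomic_monoid := AtomicMonoid E_atomic in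
    let e : atomon_hom E H := @AtomonHom E H (eq_incl f g) e_atom in
    @is_equalizer AtoMon H K f g E e.
Proof.
exists (@eq_monoid_atomic _ _ f g), (@eq_incl_atom_preserving _ _ f g) => E e.
split=> [|L h fgh].
  by apply: atomon_hom_ext => x; apply: eq_submonoid_equalizes.
have fghx x : f (h x) = g (h x).
  exact: (congr1 (fun k : atomon_hom L K => k x) fgh).
have hE := equalizing_image (@atomon_homP _ _ h) fghx.
have kA : atom_preserving (gen_corestr hE : L -> eq_monoid f g).
  by move=> a /(atomon_homP h) haA; apply/atoms_eq_val.
exists (@AtomonHom L E (gen_corestr hE) kA); split.
  by apply: atomon_hom_ext.
move=> k ekh; apply: atomon_hom_ext => x; apply: val_inj => /=.
exact: (esym (congr1 (fun j : atomon_hom L H => j x) ekh)).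
Qed.
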